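(* Let $\mathbb{F}$ be a field, $n\geq 1$ an integer, and let $A\in\mathrm{GL}_n(\mathbb{F})$ have determinant $\pm 1$. Then the matrix $A\oplus I_n\in\mathrm{GL}_{2n}(\mathbb{F})$ is the product of one involution and two $U_2$-matrices.
   Context: $A\oplus B$ denotes the block-diagonal matrix with diagonal blocks $A$ and $B$. A matrix $S\in\mathrm{GL}_m(\mathbb{F})$ is an involution if $S^2=I_m$, and a $U_2$-matrix (unipotent of index $2$) if $(S-I_m)^2=0$; $I_m$ is both. The product is of three factors of the stated types in some order (a matrix that is such a product in one prescribed order is also such a product in any other order). *)

(* Defs.v *)
From mathcomp Require Import all_boot all_order all_algebra.

Set Implicit Arguments.
Unset Strict Implicit.
Unset Printing Implicit Defensive.

Import GRing.Theory.
Local Open Scope ring_scope.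

(* Either of the two equations below forces [S] to be invertible, so that
   membership in the general linear group is not a separate requirement. *)
Definition involution_mx (F : fieldType) (m : nat) (S : 'M[F]_m) : Prop :=
  S *m S = 1%:M.

Definition U2_mx (F : fieldType) (m : nat) (S : 'M[F]_m) : Prop :=
  (S - 1%:M) *m (S - 1%:M) = 0.

(* The three factors may come in any order; since [U] and [V] play symmetric
   roles, only the position of the involution matters. *)
Definition prod_involution_U2_U2 (F : fieldType) (m : nat) (M : 'M[F]_m) :
    Prop :=
  exists S U V : 'M[F]_m,
    [/\ involution_mx S, U2_mx U, U2_mx V &
        [\/ M = S *m U *m V, M = U *m S *m V | M = U *m V *m S]].

(* Main.v *)
Require Import Defs.
From mathcomp Require Import all_boot all_order all_algebra fingroup perm.

Set Implicit Arguments.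
Unset Strict Implicit.
Unset Printing Implicit Defensive.

Import GRing.Theory.
Local Open Scope ring_scope.

(** Call a square matrix A stably factorable when A (+) I, with I of the size
    of A, is an involution times two U_2-matrices.  This property is invariant
    under similarity and passes to direct sums.  By Fitting's lemma, A is
    similar to A1 (+) A2 with A1 - I invertible and A2 unipotent; since
    det A2 = 1, also det A1 = det A, and the two summands can be treated apart.

    A unipotent matrix u is itself a product of two U_2-matrices
    ([unipotent_prod_U2_U2]).  On a Jordan block for u, apply u - 1 and
    u^-1 - 1 alternately to a cyclic vector: in the basis so obtained, u is
    the quotient of two matrices that move only the vectors of even,
    respectively odd, rank, each to the next one.

    When A - I is invertible, everything rests on [sim_correction].  Suppose
    that - A = rho B C, where rho is an involution acting trivially on the
    image of (rho B + I) (C - I).  Then A (+) I is similar to S N with S an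
    involution and N the block matrix [[C, I], [0, B]].  Indeed, S is chosen
    so that S N - I has rank n, and a rank n perturbation I + u v of the
    identity is similar to (I + v u) (+) I as soon as v u is invertible.  It
    remains to choose rho, B, C with N a product of two U_2-matrices.

    If A is not scalar, a theorem of Sourour type, proved by repeated Schur
    complements with prescribed pivots, allows B and C to be unipotent, and
    rho = diag (e, 1, ..., 1) with e = det (- A) absorbs the determinant.  Then
    N is unipotent, and the result above applies.

    If A = a I, put b = - a, so that b ^ n is 1 or -1.  Now B and C are taken
    to commute, with C - B invertible and B similar to C^-1; then N is similar
    to C (+) C^-1, which is a product of two U_2-matrices when C + I is
    invertible ([prod_U2_U2_inverse_pair]).  If b ^ n = 1, C is a weighted
    cyclic shift with C ^ n = b I, which conjugation by a diagonal matrix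
    multiplies by b.
    If b ^ n = -1 with n minimal, C and B are diagonal matrices whose entries
    are powers of b up to sign, and form a chain in which every entry of B is
    the inverse of the next entry of C. *)

(** * Similarity, direct sums and the factorization properties *)

(** The two sizes are allowed to differ as terms, so that a splitting of a
    space can be recorded without casting along an equality of dimensions. *)
Definition sim (F : fieldType) (n m : nat) (A : 'M[F]_n) (B : 'M[F]_m) : Prop :=
  exists (P : 'M_(m, n)) (Q : 'M_(n, m)),
    [/\ P *m Q = 1%:M, Q *m P = 1%:M & P *m A = B *m P].

Definition dsum (F : fieldType) (n m : nat) (A : 'M[F]_n) (B : 'M[F]_m) :
    'M[F]_(n + m) := block_mx A 0 0 B.

Definition prod_U2_U2 (F : fieldType) (m : nat) (M : 'M[F]_m) : Prop :=
  exists U V : 'M[F]_m, [/\ U2_mx U, U2_mx V & M = U *m V].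

(** The involution is put first once and for all: every construction below
    produces the factors in that order. *)
Definition prod_inv_U2_U2 (F : fieldType) (m : nat) (M : 'M[F]_m) : Prop :=
  exists S N : 'M[F]_m, [/\ involution_mx S, prod_U2_U2 N & M = S *m N].

Section Similarity.
Variable F : fieldType.

Lemma sim_refl n (A : 'M[F]_n) : sim A A.
Proof. by exists 1%:M, 1%:M; rewrite !mulmx1 !mul1mx. Qed.

Lemma sim_sym n m (A : 'M[F]_n) (B : 'M[F]_m) : sim A B -> sim B A.
Proof.
case=> P [Q [PQ QP PA]]; exists Q, P; split=> //.
by rewrite -[LHS]mulmx1 -PQ mulmxA -[Q *m B *m P]mulmxA -PA mulmxA QP mul1mx.
Qed.

Lemma sim_trans n m p (A : 'M[F]_n) (B : 'M[F]_m) (C : 'M[F]_p) :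
  sim A B -> sim B C -> sim A C.
Proof.
case=> P [Q [PQ QP PA]] [P' [Q' [PQ' QP' PB]]].
exists (P' *m P), (Q *m Q'); split.
- by rewrite -mulmxA (mulmxA P) PQ mul1mx.
- by rewrite -mulmxA (mulmxA Q') QP' mul1mx.
- by rewrite -mulmxA PA mulmxA PB mulmxA.
Qed.

Lemma sim_unit n (P A B : 'M[F]_n) :
  P \in unitmx -> P *m A = B *m P -> sim A B.
Proof. by move=> uP PA; exists P, (invmx P); rewrite mulmxV ?mulVmx. Qed.

Lemma sim_size n m (A : 'M[F]_n) (B : 'M[F]_m) : sim A B -> n = m.
Proof.
case=> P [Q [PQ QP _]]; apply/eqP; rewrite eqn_leq.
by rewrite (mulmx1_min PQ) (mulmx1_min QP).
Qed.

Lemma sim_det n m (A : 'M[F]_n) (B : 'M[F]_m) : sim A B -> \det A = \det B.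
Proof.
move=> AB; have e := sim_size AB; case: m / e B AB => B [P [Q [PQ QP PA]]].
have uP : \det P \is a GRing.unit by rewrite -unitmxE; case/mulmx1_unit: PQ.
by apply: (mulrI uP); rewrite -det_mulmx PA det_mulmx mulrC.
Qed.

Lemma sim_opp n m (A : 'M[F]_n) (B : 'M[F]_m) : sim A B -> sim (- A) (- B).
Proof.
by case=> P [Q [PQ QP PA]]; exists P, Q; rewrite mulmxN mulNmx PA.
Qed.

Lemma sim_sub1 n m (A : 'M[F]_n) (B : 'M[F]_m) :
  sim A B -> sim (A - 1%:M) (B - 1%:M).
Proof.
case=> P [Q [PQ QP PA]]; exists P, Q; split=> //.
by rewrite mulmxBr mulmxBl PA mulmx1 mul1mx.
Qed.

Lemma sim_unitmx n m (A : 'M[F]_n) (B : 'M[F]_m) :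
  sim A B -> (A \in unitmx) = (B \in unitmx).
Proof. by move=> AB; rewrite !unitmxE (sim_det AB). Qed.

Lemma sim_dsum n m n' m' (A : 'M[F]_n) (B : 'M[F]_m)
    (A' : 'M[F]_n') (B' : 'M[F]_m') :
  sim A A' -> sim B B' -> sim (dsum A B) (dsum A' B').
Proof.
case=> P [Q [PQ QP PA]] [P' [Q' [PQ' QP' PB]]].
exists (block_mx P 0 0 P'), (block_mx Q 0 0 Q').
rewrite /dsum !mulmx_block !(mul0mx, mulmx0, addr0, add0r).
by rewrite PQ PQ' QP QP' PA PB -!scalar_mx_block.
Qed.

Lemma sim_dsumACA n m p q (A : 'M[F]_n) (B : 'M[F]_m)
    (C : 'M[F]_p) (D : 'M[F]_q) :
  sim (dsum (dsum A B) (dsum C D)) (dsum (dsum A C) (dsum B D)).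
Proof.
exists (block_mx (block_mx 1%:M 0 0 0) (block_mx 0 0 1%:M 0)
                 (block_mx 0 1%:M 0 0) (block_mx 0 0 0 1%:M)).
exists (block_mx (block_mx 1%:M 0 0 0) (block_mx 0 0 1%:M 0)
                 (block_mx 0 1%:M 0 0) (block_mx 0 0 0 1%:M)).
split; rewrite /dsum !(mulmx_block, add_block_mx, mul0mx, mulmx0, addr0, add0r,
  mulmx1, mul1mx, scalar_mx_block, row_mx0, col_mx0).
all: by rewrite ?block_mx0 -?scalar_mx_block.
Qed.

Lemma dsumM n m (A A' : 'M[F]_n) (B B' : 'M[F]_m) :
  dsum A B *m dsum A' B' = dsum (A *m A') (B *m B').
Proof. by rewrite /dsum mulmx_block !(mul0mx, mulmx0, addr0, add0r). Qed.

Lemma dsum1 n m : dsum (1%:M : 'M[F]_n) (1%:M : 'M_m) = 1%:M.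
Proof. by rewrite /dsum -scalar_mx_block. Qed.

Lemma dsumB1 n m (A : 'M[F]_n) (B : 'M[F]_m) :
  dsum A B - 1%:M = dsum (A - 1%:M) (B - 1%:M).
Proof. by rewrite /dsum scalar_mx_block opp_block_mx add_block_mx !oppr0
  !addr0. Qed.

Lemma U2_dsum n m (A : 'M[F]_n) (B : 'M[F]_m) :
  U2_mx A -> U2_mx B -> U2_mx (dsum A B).
Proof. by rewrite /U2_mx dsumB1 dsumM => -> ->; rewrite /dsum block_mx0. Qed.

Lemma involution_dsum n m (A : 'M[F]_n) (B : 'M[F]_m) :
  involution_mx A -> involution_mx B -> involution_mx (dsum A B).
Proof. by rewrite /involution_mx dsumM => -> ->; rewrite dsum1. Qed.

Lemma prod_U2_U2_dsum n m (A : 'M[F]_n) (B : 'M[F]_m) :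
  prod_U2_U2 A -> prod_U2_U2 B -> prod_U2_U2 (dsum A B).
Proof.
move=> [U [V [hU hV ->]]] [U' [V' [hU' hV' ->]]].
by exists (dsum U U'), (dsum V V'); rewrite dsumM; split=> //; apply: U2_dsum.
Qed.

Lemma prod_inv_U2_U2_dsum n m (A : 'M[F]_n) (B : 'M[F]_m) :
  prod_inv_U2_U2 A -> prod_inv_U2_U2 B -> prod_inv_U2_U2 (dsum A B).
Proof.
move=> [S [N [hS hN ->]]] [S' [N' [hS' hN' ->]]].
exists (dsum S S'), (dsum N N'); rewrite dsumM; split=> //.
  exact: involution_dsum.
exact: prod_U2_U2_dsum.
Qed.

Lemma U2_1 n : U2_mx (1%:M : 'M[F]_n).
Proof. by rewrite /U2_mx subrr mulmx0. Qed.

Lemma prod_U2_U2_1 n : prod_U2_U2 (1%:M : 'M[F]_n).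
Proof. by exists 1%:M, 1%:M; rewrite mulmx1; split=> //; apply: U2_1. Qed.

Lemma involution_1 n : involution_mx (1%:M : 'M[F]_n).
Proof. by rewrite /involution_mx mulmx1. Qed.

Lemma prod_inv_U2_U2_of_prod_U2_U2 n (A : 'M[F]_n) : prod_U2_U2 A ->
  prod_inv_U2_U2 A.
Proof. by move=> hA; exists 1%:M, A; rewrite mul1mx; split=> //;
  apply: involution_1. Qed.

Lemma prod_inv_U2_U2_of_involution n (A : 'M[F]_n) : involution_mx A ->
  prod_inv_U2_U2 A.
Proof. by move=> hA; exists A, 1%:M; rewrite mulmx1; split=> //;
  apply: prod_U2_U2_1. Qed.

Lemma conjM n m (P : 'M[F]_(m, n)) (Q : 'M_(n, m)) (X Y : 'M_m) :
  P *m Q = 1%:M ->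
  Q *m (X *m Y) *m P = (Q *m X *m P) *m (Q *m Y *m P).
Proof. by move=> PQ; rewrite !mulmxA -[_ *m P *m Q]mulmxA PQ mulmx1. Qed.

Lemma sim_prod_U2_U2 n m (A : 'M[F]_n) (B : 'M[F]_m) :
  sim A B -> prod_U2_U2 B -> prod_U2_U2 A.
Proof.
case=> P [Q [PQ QP PA]] [U [V [hU hV eB]]].
have conj_U2 (W : 'M_m) : U2_mx W -> U2_mx (Q *m W *m P).
  have e : Q *m W *m P - 1%:M = Q *m (W - 1%:M) *m P.
    by rewrite mulmxBr mulmxBl mulmx1 QP.
  by move=> hW; rewrite /U2_mx e -(conjM _ _ PQ) hW mulmx0 mul0mx.
exists (Q *m U *m P), (Q *m V *m P); split; [exact: conj_U2 | exact: conj_U2 |].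
by rewrite -(conjM _ _ PQ) -eB -mulmxA -PA mulmxA QP mul1mx.
Qed.

Lemma sim_prod_inv_U2_U2 n m (A : 'M[F]_n) (B : 'M[F]_m) :
  sim A B -> prod_inv_U2_U2 B -> prod_inv_U2_U2 A.
Proof.
case=> P [Q [PQ QP PA]] [S [N [hS hN eB]]].
exists (Q *m S *m P), (Q *m N *m P); split.
- by rewrite /involution_mx -(conjM _ _ PQ) hS mulmx1 QP.
- apply: (sim_prod_U2_U2 _ hN); exists P, Q; split=> //.
  by rewrite !mulmxA PQ mul1mx.
by rewrite -(conjM _ _ PQ) -eB -mulmxA -PA mulmxA QP mul1mx.
Qed.

Definition stably_factorable n (A : 'M[F]_n) :=
  prod_inv_U2_U2 (dsum A (1%:M : 'M_n)).

Lemma stably_factorable_dsum n m (A : 'M[F]_n) (B : 'M[F]_m) :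
  stably_factorable A -> stably_factorable B -> stably_factorable (dsum A B).
Proof.
move=> hA hB; rewrite /stably_factorable -dsum1.
exact: sim_prod_inv_U2_U2 (sim_dsumACA _ _ _ _) (prod_inv_U2_U2_dsum hA hB).
Qed.

Lemma sim_stably_factorable n m (A : 'M[F]_n) (B : 'M[F]_m) :
  sim A B -> stably_factorable B -> stably_factorable A.
Proof.
move=> AB; have e := sim_size AB; case: m / e B AB => B AB.
by apply: sim_prod_inv_U2_U2; apply: sim_dsum => //; apply: sim_refl.
Qed.

End Similarity.

(** * Splitting along invariant subspaces *)

Definition nilpotent_mx (F : fieldType) n (X : 'M[F]_n) : Prop :=
  exists k, X ^+ k = 0.

Definition unipotent_mx (F : fieldType) n (X : 'M[F]_n) : Prop :=
  nilpotent_mx (X - 1%:M).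

Section Splitting.
Variable F : fieldType.

Lemma sim_split n p q (A : 'M[F]_n) (I : 'M_(p, n)) (K : 'M_(q, n))
    (A1 : 'M_p) (A2 : 'M_q) :
  row_free (col_mx I K) -> (p + q)%N = n ->
  I *m A = A1 *m I -> K *m A = A2 *m K -> sim A (dsum A1 A2).
Proof.
move=> fW en IA KA; exists (col_mx I K), (pinvmx (col_mx I K)); split.
- exact: mulmxVp.
- by apply: mulVpmx; rewrite /row_full; move: fW; rewrite /row_free => /eqP->;
  rewrite en.
- by rewrite /dsum mul_col_mx mul_block_col !mul0mx addr0 add0r IA KA.
Qed.

Lemma sim_restrict n p q (A : 'M[F]_n) (V : 'M_(p, n)) (W : 'M_(q, n)) :
  stablemx V A -> stablemx W A -> (1%:M <= V + W)%MS -> (V :&: W)%MS = 0 ->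
  exists (A1 : 'M_(\rank V)) (A2 : 'M_(\rank W)),
    [/\ sim A (dsum A1 A2), row_base V *m A = A1 *m row_base V
      & row_base W *m A = A2 *m row_base W].
Proof.
move=> sV sW VW1 VW0.
have restr m (X : 'M_(m, n)) : stablemx X A ->
    row_base X *m A = row_base X *m A *m pinvmx (row_base X) *m row_base X.
  move=> sX; rewrite mulmxKpV //.
  by rewrite (eqmxMr A (eq_row_base X)) eq_row_base.
exists (row_base V *m A *m pinvmx (row_base V)),
  (row_base W *m A *m pinvmx (row_base W)).
have en : (\rank V + \rank W)%N = n.
  have := mxrank_sum_cap V W; rewrite VW0 mxrank0 addn0 => <-.
  by apply/eqP; rewrite -[_ == _]/(row_full (V + W)%MS) -sub1mx.
split; [|exact: restr|exact: restr].
apply: (sim_split (I := row_base V) (K := row_base W)) => //;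
  [|exact: restr|exact: restr].
rewrite /row_free -addsmxE en.
apply/eqP/anti_leq/andP; split; first by rewrite rank_leq_col.
rewrite -[X in (X <= _)%N](mxrank1 F n); apply: mxrankS.
by rewrite (adds_eqmx (eq_row_base V) (eq_row_base W)).
Qed.

Lemma intertwine_exp n p (A : 'M[F]_n) (B : 'M_p) (V : 'M_(p, n)) k :
  V *m A = B *m V -> V *m (A ^+ k) = B ^+ k *m V.
Proof.
move=> VA; elim: k => [|k IH]; first by rewrite !expr0 mulmx1 mul1mx.
by rewrite !exprS mulmxA VA -mulmxA IH mulmxA.
Qed.

Lemma intertwine_sub1 n p (A : 'M[F]_n) (B : 'M_p) (V : 'M_(p, n)) :
  V *m A = B *m V -> V *m (A - 1%:M) = (B - 1%:M) *m V.
Proof. by move=> VA; rewrite mulmxBr mulmxBl VA mulmx1 mul1mx. Qed.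

Lemma unipotent_restrict n p (A : 'M[F]_n) (B : 'M_p) (V : 'M_(p, n)) k :
  row_free V -> V *m A = B *m V -> V *m (A - 1%:M) ^+ k = 0 ->
  unipotent_mx B.
Proof.
move=> fV VA VAk; exists k; apply: (row_free_inj fV).
by rewrite mul0mx -(intertwine_exp k (intertwine_sub1 VA)).
Qed.

(** The characteristic polynomial is q * ('X - 1) ^ m with q(1) <> 0, and the
    two coprime factors cut the space into two invariant kernels.  On the
    kernel of q the value 1 is no longer an eigenvalue. *)
Lemma fitting_at_1 n (A : 'M[F]_n) : exists p q (A1 : 'M_p) (A2 : 'M_q),
  [/\ sim A (dsum A1 A2), A1 - 1%:M \in unitmx & unipotent_mx A2].
Proof.
case: n A => [|n] A.
  exists 0, 0, A, A; split; last by exists 1%N;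
    rewrite [LHS]flatmx0 [RHS]flatmx0.
    by apply: (sim_unit (P := 1%:M));
      rewrite ?unitmx1 // [LHS]flatmx0 [RHS]flatmx0.
  have -> : A - 1%:M = 1%:M by rewrite [LHS]flatmx0 [RHS]flatmx0.
  exact: unitmx1.
have [m [q nq pq]] := multiplicity_XsubC (char_poly A) 1.
have cq : coprimep q ('X - 1%:P).
  by rewrite coprimep_XsubC; move: nq; rewrite monic_neq0 ?char_poly_monic.
have cqm : coprimep q (('X - 1%:P) ^+ m) by rewrite coprimep_expr.
have hX : horner_mx A (('X - 1%:P) ^+ m) = (A - 1%:M) ^+ m.
  by rewrite rmorphXn rmorphB /= horner_mx_X horner_mx_C.
set V := kermxpoly A q; set W := kermxpoly A (('X - 1%:P) ^+ m).
have [||||A1 [A2 [sA VA WA]]] := @sim_restrict _ _ _ A V W.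
- exact: comm_mx_stable_kermxpoly.
- exact: comm_mx_stable_kermxpoly.
- rewrite -(kermxpolyM A cqm) -pq /kermxpoly Cayley_Hamilton.
  by rewrite kermx0 submx_refl.
- exact: mxdirect_kermxpoly.
exists (\rank V), (\rank W), A1, A2; split=> //.
  rewrite -row_free_unit -kermx_eq0 -submx0.
  have : (kermx (A1 - 1%:M) *m row_base V <= V :&: kermxpoly A ('X - 1%:P))%MS.
    rewrite sub_capmx; apply/andP; split.
      by apply: submx_trans (submxMl _ _) _; rewrite eq_row_base.
    apply/sub_kermxP; rewrite rmorphB /= horner_mx_X horner_mx_C.
    by rewrite -mulmxA (intertwine_sub1 VA) mulmxA mulmx_ker mul0mx.
  rewrite mxdirect_kermxpoly // !submx0 => /eqP k0; apply/eqP.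
  by apply: (row_free_inj (row_base_free V)); rewrite k0 mul0mx.
apply: (unipotent_restrict (k := m) (row_base_free W) WA).
by rewrite -hX; apply/sub_kermxP; rewrite eq_row_base.
Qed.

(** For N nilpotent, 1 + 'X N is invertible over the polynomial ring, so its
    determinant is a constant; compare the values at 0 and at 1. *)
Lemma det_unipotent n (A : 'M[F]_n) : unipotent_mx A -> \det A = 1.
Proof.
case=> k; set N := A - 1%:M => Nk.
pose M : 'M[{poly F}]_n := 1%:M - (- 'X) *: map_mx polyC N.
have uM : M \in unitmx.
  have : M *m \sum_(i < k) ((- 'X) *: map_mx polyC N) ^+ i = 1%:M.
    have -> : M = - ((- 'X) *: map_mx polyC N - 1) by rewrite opprB.
    rewrite mulNmx -[_ *m _]/(_ * _) -subrX1.
    have XN i (x : {poly F}) :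
      (x *: map_mx polyC N) ^+ i = x ^+ i *: map_mx polyC (N ^+ i).
      elim: i => [|i IH]; first by rewrite !expr0 scale1r map_mx1.
      by rewrite !exprS IH -[_ * _]/(_ *m _) -scalemxAl -scalemxAr scalerA
        -map_mxM.
    by rewrite XN Nk map_mx0 scaler0 sub0r opprK.
  by case/mulmx1_unit.
move: uM; rewrite unitmxE poly_unitE => /andP[/size_poly1P[c c0 dM] _].
have ev x : c = \det (1%:M + x *: N).
  have := congr1 (horner^~ x) dM; rewrite hornerC => <-.
  rewrite -horner_evalE -det_map_mx; congr (\det _).
  apply/matrixP => i j; rewrite !mxE /= horner_evalE !hornerE.
  by rewrite mulNr opprK; case: (i == j); rewrite /= ?hornerE.
have := ev 1; rewrite scale1r /N addrC subrK => <-.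
by rewrite (ev 0) scale0r addr0 det1.
Qed.

End Splitting.

(** * Unipotent matrices are products of two U_2-matrices *)

Section Unipotent.
Variable F : fieldType.

(** The nilpotent Jordan block, keeping only the rows whose parity is [b]: two
    such steps can never be chained, hence the square is zero. *)
Definition parity_shift k (b : bool) : 'M[F]_k :=
  \matrix_(i, j) ((odd i == b) && (j == i.+1 :> nat))%:R.

Lemma parity_shift_sqr k b : parity_shift k b *m parity_shift k b = 0.
Proof.
apply/matrixP => i j; rewrite !mxE big1 // => l _; rewrite !mxE.
case: eqP => [oi|_] /=; last by rewrite mul0r.
case: eqP => [->|_] /=; last by rewrite mul0r.
by rewrite oi; case: b {oi}; rewrite mulr0.
Qed.

Lemma U2_parity_shift k b : U2_mx (1%:M + parity_shift k b).
Proof. by rewrite /U2_mx addrC addKr parity_shift_sqr. Qed.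

Lemma U2_parity_shiftN k b : U2_mx (1%:M - parity_shift k b).
Proof.
by rewrite /U2_mx addrC addKr mulNmx mulmxN opprK parity_shift_sqr.
Qed.

Lemma mul_parity_shift k n b (w : nat -> 'rV[F]_n) (i : 'I_k) : w k = 0 ->
  row i (parity_shift k b *m (\matrix_(i < k) w i))
  = if odd i == b then w i.+1 else 0.
Proof.
move=> wk; rewrite row_mul; apply/rowP => l; rewrite mxE.
under eq_bigr do rewrite !mxE.
case: eqP => [_|_] /=; last by rewrite big1 ?mxE // => j _; rewrite mul0r.
have [lt_ik|] := ltnP i.+1 k.
  rewrite (bigD1 (Ordinal lt_ik)) //= eqxx mul1r big1 ?addr0 // => j.
  by rewrite -val_eqE /= => /negPf->; rewrite mul0r.
move=> le_ki; have -> : i.+1 = k by apply/eqP; rewrite eqn_leq le_ki ltn_ord.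
rewrite wk mxE big1 // => j _.
by rewrite ltn_eqF ?mul0r // (leq_trans (ltn_ord j)).
Qed.

(** Let w_i be the i-th row of R, and T = u - 1.  As u^-1 - 1 = - u^-1 T, these
    rows satisfy w_(i+1) = w_i (u - 1) for i even and w_(i+1) = w_i (u^-1 - 1)
    for i odd, with w_k = 0.  So, with E0 and E1 the even and the odd shift,
    (1 + E1) R u = (1 + E0) R, and 1 + E1 has inverse 1 - E1. *)
Lemma cyclic_unipotent_block n k (u : 'M[F]_n) (y : 'rV_n) :
  u \in unitmx -> (u - 1%:M) ^+ k = 0 ->
  let T := u - 1%:M in
  let R := \matrix_(i < k) (y *m T ^+ i *m (- invmx u) ^+ i./2) in
  R *m u = (1%:M - parity_shift k true) *m (1%:M + parity_shift k false) *m R.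
Proof.
move=> uu Tk T; set v := invmx u => R.
pose w i := y *m T ^+ i *m (- v) ^+ i./2.
have wk : w k = 0 by rewrite /w Tk mulmx0 mul0mx.
have Tv : T *m v = 1%:M - v by rewrite mulmxBl mulmxV // mul1mx.
have vT : v *m T = 1%:M - v by rewrite mulmxBr mulVmx // mulmx1.
have cTv : GRing.comm T (- v) by rewrite /GRing.comm mulrN mulNr -!mulmxE Tv vT.
have w_even i : ~~ odd i -> w i *m u = w i + w i.+1.
  move=> ei; have -> : u = 1%:M + T by rewrite addrC subrK.
  rewrite mulmxDr mulmx1; congr (_ + _).
  rewrite /w [in RHS]/= uphalf_half (negPf ei) add0n exprSr -mulmxE.
  by rewrite -!mulmxA; congr (_ *m (_ *m _)); exact: esym (commrX _ cTv).
have w_odd i : odd i -> (w i + w i.+1) *m u = w i.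
  move=> oi; have -> : w i + w i.+1 = w i *m v.
    have -> : v = 1%:M + T *m (- v) by rewrite mulmxN Tv opprB addrC subrK.
    rewrite mulmxDr mulmx1; congr (_ + _).
    rewrite /w [in LHS]/= uphalf_half oi add1n exprSr -mulmxE.
    rewrite -!mulmxA; congr (_ *m (_ *m _)).
    rewrite exprSr -mulmxE !mulmxA; congr (_ *m _); exact: commrX cTv.
  by rewrite -mulmxA mulVmx // mulmx1.
have key : (1%:M + parity_shift k true) *m R *m u
    = (1%:M + parity_shift k false) *m R.
  apply/row_matrixP => i; rewrite row_mul.
  have rowE b : row i ((1%:M + parity_shift k b) *m R)
      = w i + if odd i == b then w i.+1 else 0.
    rewrite mulmxDl mul1mx linearD /= (mul_parity_shift b i wk).
    by rewrite rowK.
  rewrite !rowE; have [oi|ei] := boolP (odd i); rewrite /= ?addr0.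
    exact: w_odd.
  exact: w_even.
rewrite -mulmxA -key !mulmxA.
rewrite mulmxDr mulmx1 mulmxBl mul1mx parity_shift_sqr subr0 subrK.
by rewrite mul1mx.
Qed.

Lemma nilpotent_index n (T : 'M[F]_n.+1) : nilpotent_mx T ->
  exists2 k, T ^+ k.+1 = 0 & T ^+ k != 0.
Proof.
move=> nT; have ex : exists k, T ^+ k == 0 by case: nT => k Tk; exists k;
  rewrite Tk.
case: (ex_minnP ex) => -[|k] /eqP Tk min; first by move/eqP: Tk;
  rewrite expr0 oner_eq0.
by exists k => //; apply/negP => /min; rewrite ltnn.
Qed.

Lemma unitmx_uptriangular n (H : 'M[F]_n) :
  (forall i j : 'I_n, (j < i)%N -> H i j = 0) -> (forall i, H i i != 0) ->
  H \in unitmx.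
Proof.
move=> H0 Hd; rewrite -unitmx_tr unitmxE det_trig.
  by rewrite unitfE; apply/prodf_neq0 => i _; rewrite mxE.
by apply/is_trig_mxP => i j ij; rewrite mxE H0.
Qed.

(** A cyclic subspace of maximal dimension has an invariant complement.  If
    T ^ k is the last nonzero power and its entry (a, b) is not zero, take the
    row vectors w_i generated by the a-th basis vector, and as complement the
    common kernel of the k + 1 columns T ^ (k - j) e_b.  Pairing the w_i with
    these columns gives a triangular matrix with nonzero diagonal entries, so
    the two subspaces are indeed complementary; the complement is handled by
    induction. *)
Lemma unipotent_prod_U2_U2 n (u : 'M[F]_n) : unipotent_mx u -> prod_U2_U2 u.
Proof.
elim/ltn_ind: n u => -[|n] IH u uu.
  have -> : u = 1%:M by rewrite [LHS]flatmx0 [RHS]flatmx0.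
  exact: prod_U2_U2_1.
have unitu : u \in unitmx by rewrite unitmxE (det_unipotent uu) unitr1.
have [k Tk Tk0] := nilpotent_index uu.
set T := u - 1%:M in Tk Tk0; set v := invmx u.
have [a [b Tab]] : exists a b, (T ^+ k) a b != 0.
  case: (pickP (fun ij => (T ^+ k) ij.1 ij.2 != 0)) => [[a b] ab|T0].
    by exists a, b.
  case/eqP: Tk0; apply/matrixP => i j.
  by have /negbFE/eqP-> := T0 (i, j); rewrite mxE.
pose y : 'rV[F]_n.+1 := delta_mx 0 a.
pose R := \matrix_(i < k.+1) (y *m T ^+ i *m (- v) ^+ i./2).
pose C := \matrix_(i < n.+1, j < k.+1) (T ^+ (k - j)) i b.
have Ru := cyclic_unipotent_block y unitu Tk.
rewrite -/T -/v -/R in Ru.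
have Tge m : (k < m)%N -> T ^+ m = 0.
  by move=> km; rewrite -(subnKC km) exprD Tk mul0r.
have Tv : T *m v = 1%:M - v by rewrite mulmxBl mulmxV // mul1mx.
have vT : v *m T = 1%:M - v by rewrite mulmxBr mulVmx // mulmx1.
have cTv : GRing.comm T (- v) by rewrite /GRing.comm mulrN mulNr -!mulmxE Tv vT.
have RC i j : (R *m C) i j = (T ^+ (i + (k - j)) * (- v) ^+ i./2) a b.
  have -> : T ^+ (i + (k - j)) * (- v) ^+ i./2
      = T ^+ i * (- v) ^+ i./2 * T ^+ (k - j).
    by rewrite exprD -!mulrA; congr (_ * _); apply: commrX;
      apply/commr_sym/commrX/commr_sym.
  rewrite [LHS]mxE [RHS]mxE; apply: eq_bigr => l _.
  rewrite [R _ _]mxE [C _ _]mxE; congr (_ * _).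
  by rewrite -mulmxA -rowE [row _ _ _ _]mxE.
have Tkv m : T ^+ k * (- v) ^+ m = (-1) ^+ m *: T ^+ k.
  elim: m => [|m IHm]; first by rewrite !expr0 mulr1 scale1r.
  rewrite exprSr mulrA IHm -scalerAl mulrN scalerN.
  have -> : T ^+ k * v = T ^+ k.
    have Tku : T ^+ k * u = T ^+ k.
      have -> : u = 1 + T by rewrite addrC subrK.
      by rewrite mulrDr mulr1 -exprSr Tk addr0.
    by rewrite -[in LHS]Tku; apply: mulmxK.
  by rewrite exprS mulN1r scaleNr.
(* Entry (i, j) is, up to units commuting with T, read off T ^ (i + k - j):
   it vanishes below the diagonal and is the nonzero entry of T ^ k, up to
   sign, on it. *)
have uH : R *m C \in unitmx.
  apply: unitmx_uptriangular => [i j ji|i].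
    rewrite RC Tge; first by rewrite mul0r mxE.
    have jk : (j <= k)%N by rewrite -ltnS.
    by rewrite addnBA // ltn_subRL ltn_add2r.
  have ik : (i <= k)%N by rewrite -ltnS.
  rewrite RC subnKC // Tkv mxE mulf_eq0 negb_or Tab andbT.
  by rewrite signr_eq0.
pose K := row_base (kermx C).
have rC : \rank C = k.+1.
  apply/anti_leq; rewrite rank_leq_col /=.
  by rewrite -[X in (X <= _)%N](mxrank_unit uH) mxrankM_maxr.
have en : (k.+1 + \rank (kermx C))%N = n.+1.
  by rewrite mxrank_ker rC subnKC // -rC rank_leq_row.
(* T sends each column of C to the previous one, and kills the first. *)
have TC : kermx C *m T *m C = 0.
  apply/matrixP => i j.
  have -> : (kermx C *m T *m C) i j = (kermx C *m T ^+ (k - j).+1) i b.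
    rewrite -mulmxA exprS [LHS]mxE [RHS]mxE; apply: eq_bigr => l _;
      congr (_ * _).
    by rewrite [LHS]mxE [RHS]mxE; apply: eq_bigr => l' _; rewrite [C _ _]mxE.
  case: j => -[|j] hj; first by rewrite /= subn0 Tk mulmx0 !mxE.
  have hj' := ltnW hj.
  have -> : (k - Ordinal hj).+1 = (k - Ordinal hj')%N by rewrite /= subnSK.
  transitivity ((kermx C *m C) i (Ordinal hj')); last by rewrite mulmx_ker !mxE.
  by rewrite [LHS]mxE [RHS]mxE; apply: eq_bigr => l _; rewrite [C _ _]mxE.
have sK : stablemx (kermx C) u.
  apply/sub_kermxP; have -> : u = T + 1%:M by rewrite subrK.
  by rewrite mulmxDr mulmx1 mulmxDl TC mulmx_ker addr0.
pose A2 := K *m u *m pinvmx K.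
have Ku : K *m u = A2 *m K.
  by rewrite mulmxKpV // (eqmxMr u (eq_row_base _)) eq_row_base.
have fRK : row_free (col_mx R K).
  have fR : row_free R.
    by rewrite /row_free eqn_leq rank_leq_row -{1}(mxrank_unit uH) mxrankM_maxl.
  have RK0 : (R :&: K)%MS = 0.
    apply/eqP; rewrite -submx0; apply/rV_subP => z;
      rewrite sub_capmx eq_row_base.
    case/andP => /submxP[c ->] /sub_kermxP.
    rewrite -mulmxA => /(congr1 (mulmx^~ (invmx (R *m C)))).
    by rewrite mulmxK // mul0mx => ->; rewrite mul0mx sub0mx.
  rewrite /row_free -addsmxE -(addn0 (\rank _)) -(mxrank0 F n.+1 n.+1) -RK0
    mxrank_sum_cap.
  by rewrite (eqP fR) (eqP (row_base_free _)).
apply: (sim_prod_U2_U2 (sim_split fRK en Ru Ku)); apply: prod_U2_U2_dsum.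
  exists (1%:M - parity_shift k.+1 true), (1%:M + parity_shift k.+1 false).
  by split=> //; [apply: U2_parity_shiftN | apply: U2_parity_shift].
apply: IH; first by rewrite -[X in (_ < X)%N]en addSn ltnS leq_addl.
by apply: (unipotent_restrict (k := k.+1) (row_base_free _) Ku);
  rewrite Tk mulmx0.
Qed.

End Unipotent.

(** * Correcting the stabilization by an involution *)

Section Core.
Variable F : fieldType.

Lemma involution_correction n (X rho : 'M[F]_n) :
  rho *m rho = 1%:M -> rho *m X = X ->
  involution_mx (block_mx 1%:M 0 X (- rho)).
Proof.
move=> rho2 rhoX; rewrite /involution_mx mulmx_block.
by rewrite !(mulmx0, mul0mx, mulmx1, mul1mx, addr0, add0r, mulNmx, mulmxN,
  opprK)
  rho2 rhoX subrr -scalar_mx_block.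
Qed.

(** The lower left block of the involution S = [[1, 0], [X, - rho]] is the one
    for which S N - 1 has rank n: S N = 1 + u v with v = (C - 1, 1) and
    u = (1, w), w = - (rho B + 1) C, while v u = C - 1 + w = A - 1.  The rows
    of v span an invariant subspace on which 1 + u v acts as 1 + v u = A, and
    those of (w, -1), which annihilate u, are fixed. *)
Lemma sim_correction n (A B C rho : 'M[F]_n) :
  A - 1%:M \in unitmx -> - A = rho *m B *m C ->
  let X := - ((rho *m B + 1%:M) *m (C - 1%:M)) in
  sim (dsum A (1%:M : 'M_n))
      (block_mx 1%:M 0 X (- rho) *m block_mx C 1%:M 0 B).
Proof.
move=> uA eA X0; apply: sim_sym.
have [X eX] : exists X, X = X0 by eexists.
rewrite -eX; rewrite /X0 {X0} in eX.
have [w ew] : exists w, w = - ((rho *m B + 1%:M) *m C) by eexists.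
have eAw : A = C + w.
  by rewrite ew mulmxDl mul1mx opprD addrCA subrr addr0 -eA opprK.
have cC : (C - 1%:M) *m C = C *m (C - 1%:M).
  by rewrite mulmxBl mulmxBr mulmx1 mul1mx.
have eXC : X *m C = w *m (C - 1%:M) by rewrite eX ew !mulNmx -!mulmxA cC.
have eXB : X - rho *m B = w + 1%:M.
  by rewrite eX ew mulmxBr mulmx1 opprB addrC addrA addKr addrC.
have eD : A - 1%:M = C - 1%:M + w by rewrite eAw addrAC.
pose D' := invmx (A - 1%:M).
have DD : (C - 1%:M) *m D' + w *m D' = 1%:M by rewrite -mulmxDl -eD mulmxV.
pose P := block_mx (C - 1%:M) 1%:M w (- 1%:M).
pose Q := block_mx D' D' (w *m D') (w *m D' - 1%:M).
have PQ : P *m Q = 1%:M.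
  rewrite /P /Q mulmx_block !mulNmx !mul1mx addrA DD !subrr.
  by rewrite opprB addrCA subrr addr0 -scalar_mx_block.
exists P, Q; split=> //; first exact: mulmx1C.
rewrite /P /dsum !mulmx_block !(mul0mx, mulmx0, mul1mx, mulmx1, addr0, add0r).
rewrite !(mulmxN, mulNmx, mul1mx, mulmx1) eXC eXB.
congr block_mx.
- by rewrite eAw cC -mulmxDl.
- by rewrite addrA -eD subrK.
- by rewrite mulmxBr mulmx1 opprB addrCA subrr addr0.
- by rewrite opprD addrA subrr add0r.
Qed.

Lemma stably_factorable_of_factorization n (A B C rho : 'M[F]_n) :
  A - 1%:M \in unitmx -> - A = rho *m B *m C -> rho *m rho = 1%:M ->
  rho *m ((rho *m B + 1%:M) *m (C - 1%:M)) = (rho *m B + 1%:M) *m (C - 1%:M) ->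
  prod_U2_U2 (block_mx C 1%:M 0 B) -> stably_factorable A.
Proof.
move=> uA eA rho2 rhoX hN; apply: sim_prod_inv_U2_U2 (sim_correction uA eA) _.
exists (block_mx 1%:M 0 (- ((rho *m B + 1%:M) *m (C - 1%:M))) (- rho)).
exists (block_mx C 1%:M 0 B); split=> //.
by apply: involution_correction; rewrite // mulmxN rhoX.
Qed.

(** A Sylvester equation C Y - Y B = 1 decides whether the off-diagonal block
    can be removed; in the commuting case its solution is (C - B)^-1. *)
Lemma sim_ublock n (B C : 'M[F]_n) :
  B *m C = C *m B -> C - B \in unitmx ->
  sim (block_mx C 1%:M 0 B) (dsum C B).
Proof.
move=> cBC uCB; set Y := invmx (C - B).
have cY : Y *m B = B *m Y.
  rewrite -[LHS]mulmx1 -(mulmxV uCB) -/Y mulmxA -[_ *m B *m _]mulmxA.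
  by rewrite mulmxBr cBC -mulmxBl !mulmxA mulVmx // mul1mx.
exists (block_mx 1%:M Y 0 1%:M), (block_mx 1%:M (- Y) 0 1%:M).
rewrite /dsum !mulmx_block !(mul0mx, mulmx0, mul1mx, mulmx1, addr0, add0r).
rewrite addNr subrr -scalar_mx_block; split=> //.
by rewrite cY -[X in X + _](mulmxV uCB) -/Y mulmxBl subrK.
Qed.

(** The Cayley transform E = (C - 1) (C + 1)^-1 satisfies
    (1 - E) C = 1 + E.  The factors are U = 1 + E (1, 1)^T (1, -1) and
    V = U^-1 (C (+) C^-1), which this identity makes unipotent of index 2.
    For a scalar C = c <> 1, the diagonal entries of U are forced: V has trace 2
    only if the first one is 2 c / (1 + c) = 1 + E. *)
Lemma prod_U2_U2_inverse_pair n (C : 'M[F]_n) :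
  C \in unitmx -> 1%:M + C \in unitmx -> prod_U2_U2 (dsum C (invmx C)).
Proof.
move=> uC uC1; set G := invmx C.
pose E := (C - 1%:M) *m invmx (1%:M + C).
have CG : C *m G = 1%:M by rewrite mulmxV.
have GC : G *m C = 1%:M by rewrite mulVmx.
have cE1 : (C - 1%:M) *m (1%:M + C) = (1%:M + C) *m (C - 1%:M).
  by rewrite mulmxBl mulmxBr mulmxDl mulmxDr !(mul1mx, mulmx1).
have E1 : E *m (1%:M + C) = C - 1%:M by rewrite -mulmxA mulVmx ?mulmx1.
have E2 : (1%:M + C) *m E = C - 1%:M.
  by rewrite mulmxA -cE1 -mulmxA mulmxV ?mulmx1.
have EC : E *m C = C *m E.
  have : E *m (1%:M + C) = (1%:M + C) *m E by rewrite E1 E2.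
  by rewrite mulmxDr mulmxDl mulmx1 mul1mx => /addrI.
have EG : E *m G = G *m E.
  by rewrite -[LHS]mul1mx -GC -mulmxA (mulmxA C) -EC -(mulmxA E) CG mulmx1.
have key : (1%:M - E) *m C = 1%:M + E.
  rewrite mulmxBl mul1mx; apply/eqP; rewrite subr_eq -addrA.
  move: E1; rewrite mulmxDr mulmx1 => ->; by rewrite addrCA subrr addr0.
have key' : (1%:M + E) *m G = 1%:M - E by rewrite -key -mulmxA CG mulmx1.
clearbody E G.
exists (block_mx (1%:M + E) (- E) E (1%:M - E)).
exists (block_mx (1%:M + E) (E *m G) (- (E *m C)) (1%:M - E)).
have mulE : (1%:M + E) *m (1%:M - E) = 1%:M - E *m E.
  by rewrite mulmxBr mulmx1 mulmxDl mul1mx opprD addrA addrK.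
have mulE' : (1%:M - E) *m (1%:M + E) = 1%:M - E *m E.
  by rewrite mulmxDr mulmx1 mulmxBl mul1mx addrA subrK.
have cE : E *m (1%:M + E) = (1%:M + E) *m E.
  by rewrite mulmxDr mulmxDl mulmx1 mul1mx.
have cE' : E *m (1%:M - E) = (1%:M - E) *m E.
  by rewrite mulmxBr mulmxBl mulmx1 mul1mx.
have sub1 (a b c d : 'M[F]_n) : block_mx (1%:M + a) b c (1%:M - d) - 1%:M
    = block_mx a b c (- d).
  rewrite scalar_mx_block opp_block_mx add_block_mx !subr0.
  by rewrite addrC addKr addrAC subrr add0r.
split.
- rewrite /U2_mx sub1 mulmx_block !(mulmxN, mulNmx, opprK) subrr.
  by rewrite addNr block_mx0.
- rewrite /U2_mx sub1 mulmx_block !(mulmxN, mulNmx, opprK).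
  have e1 : E *m G *m (E *m C) = E *m E.
    by rewrite EC -mulmxA (mulmxA G) GC mul1mx.
  have e2 : E *m C *m (E *m G) = E *m E.
    by rewrite EG -mulmxA (mulmxA C) CG mul1mx.
  rewrite e1 e2 -[E *m C *m E]mulmxA -EC -[E *m G *m E]mulmxA -EG.
  by rewrite !subrr !addNr block_mx0.
rewrite /dsum mulmx_block !(mulmxN, mulNmx, opprK); congr block_mx.
- rewrite -{2}key mulmxA mulE mulmxBl mul1mx mulmxA subrK //.
- by rewrite mulmxA -cE -mulmxA key' subrr.
- by rewrite mulmxA -cE' -mulmxA key subrr.
- by rewrite -{2}key' !mulmxA mulE' mulmxBl mul1mx addrC subrK.
Qed.

End Core.

(** * Nonscalar matrices *)

Section Nonscalar.
Variable F : fieldType.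

Lemma nilpotent_tr n (X : 'M[F]_n) : nilpotent_mx X -> nilpotent_mx X^T.
Proof.
case=> k Xk; exists k; rewrite -[0]trmx0 -Xk.
elim: k {Xk} => [|k IH]; first by rewrite !expr0 trmx1.
by rewrite exprS IH exprSr -[RHS]trmxK trmx_mul trmxK.
Qed.

Lemma nilpotent_ublock n m (X : 'M[F]_n) (Y : 'M_(n, m)) (Z : 'M_m) :
  nilpotent_mx X -> nilpotent_mx Z -> nilpotent_mx (block_mx X Y 0 Z).
Proof.
case=> i Xi [j Zj].
have powE k : exists Y',
  block_mx X Y 0 Z ^+ k = block_mx (X ^+ k) Y' 0 (Z ^+ k).
  elim: k => [|k [Y' IH]]; first by exists 0; rewrite !expr0 -scalar_mx_block.
  rewrite !exprS IH -!mulmxE mulmx_block !(mul0mx, mulmx0, add0r, addr0).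
  by eexists.
have [Y' e] := powE (i + j)%N.
exists ((i + j) * 2)%N; rewrite exprM e !exprD Xi Zj mul0r mulr0 expr2 -mulmxE.
by rewrite mulmx_block !(mul0mx, mulmx0, add0r) block_mx0.
Qed.

Lemma unipotent_ublock n m (X : 'M[F]_n) (Y : 'M_(n, m)) (Z : 'M_m) :
  unipotent_mx X -> unipotent_mx Z -> unipotent_mx (block_mx X Y 0 Z).
Proof.
rewrite /unipotent_mx => hX hZ.
rewrite scalar_mx_block opp_block_mx add_block_mx !oppr0 !addr0.
exact: nilpotent_ublock.
Qed.

Lemma unipotent_1 n : unipotent_mx (1%:M : 'M[F]_n).
Proof. by exists 1%N; rewrite subrr expr1. Qed.

Lemma unipotent_lblock n m (X : 'M[F]_n) (Y : 'M_(m, n)) (Z : 'M_m) :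
  unipotent_mx X -> unipotent_mx Z -> unipotent_mx (block_mx X 0 Y Z).
Proof.
have tr1 k (W : 'M[F]_k) : unipotent_mx W -> unipotent_mx W^T.
  by rewrite /unipotent_mx -{2}[1%:M]trmx1 -linearB; apply: nilpotent_tr.
move=> hX hZ; rewrite -[block_mx _ _ _ _]trmxK tr_block_mx trmx0.
by apply/tr1/unipotent_ublock; apply: tr1.
Qed.

Lemma diag_nonscalar_entries n (G : 'M[F]_n) : ~~ is_scalar_mx G ->
  is_diag_mx G ->
  exists i j, G i i != G j j.
Proof.
case: n G => [|n] G nG dG; first by rewrite [G]flatmx0 mx0_is_scalar in nG.
case: (pickP (fun i => G i i != G 0 0)) => [i h|h]; first by exists i, 0.
case/negP: nG; apply/is_scalar_mxP; exists (G 0 0); apply/matrixP => i j.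
rewrite mxE; have [<-|ij] := eqVneq i j; first by have /negbFE/eqP-> := h i.
by have /is_diag_mxP-> := dG.
Qed.

(** If G is diagonal with distinct entries at i and j, conjugating it by
    1 + E_ij creates the entry G_jj - G_ii at (i, j). *)
Lemma nonscalar_sim_nondiag n (G : 'M[F]_n) : ~~ is_scalar_mx G ->
  exists2 G' : 'M_n, sim G G' & ~~ is_diag_mx G'.
Proof.
move=> nG; have [dG|ndG] := boolP (is_diag_mx G); last by exists G => //;
  apply: sim_refl.
have [i [j Gij]] := diag_nonscalar_entries nG dG.
have ij : i != j by apply: contraNneq Gij => ->.
pose E : 'M[F]_n := delta_mx i j.
have EE : E *m E = 0 by rewrite /E mul_delta_mx_0 // eq_sym.
exists ((1%:M + E) *m G *m (1%:M - E)).
  exists (1%:M + E), (1%:M - E).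
  have e1 : (1%:M + E) *m (1%:M - E) = 1%:M.
    by rewrite mulmxBr mulmx1 mulmxDl mul1mx EE addr0 addrK.
  have e2 : (1%:M - E) *m (1%:M + E) = 1%:M by apply: mulmx1C.
  by split=> //; rewrite -[RHS]mulmxA e2 mulmx1.
have GE : G *m E = G i i *: E.
  apply/matrixP => k l; rewrite !mxE (bigD1 i) //= big1 => [|m mi].
    rewrite addr0 mxE eqxx; have [->|ki] := eqVneq k i; first by [].
    have /is_diag_mxP-> // := dG.
    by rewrite mul0r mulr0.
  by rewrite mxE (negPf mi) mulr0.
have EG : E *m G = G j j *: E.
  apply/matrixP => k l; rewrite !mxE (bigD1 j) //= big1 => [|m mj].
    rewrite addr0 mxE eqxx andbT; have [->|lj] := eqVneq l j;
      first by rewrite andbT mulrC.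
    have /is_diag_mxP-> // := dG; last by rewrite eq_sym.
    by rewrite mulr0 andbF mulr0.
  by rewrite mxE (negPf mj) andbF mul0r.
apply/negP => /is_diag_mxP/(_ i j ij)/eqP.
rewrite mulmxBr mulmx1 mulmxDl mul1mx EG mulmxDl GE -scalemxAl EE scaler0 addr0.
have /is_diag_mxP h := dG.
rewrite !mxE !eqxx h // add0r !mulr1 subr_eq0 => /eqP e.
by rewrite e eqxx in Gij.
Qed.

Lemma nonscalar_sim_column n (G : 'M[F]_(1 + n)) : ~~ is_scalar_mx G ->
  exists (a : F) (r : 'rV_n) (l : 'cV_n) (G' : 'M_n),
    l != 0 /\ sim G (block_mx a%:M r l G').
Proof.
case/nonscalar_sim_nondiag => H GH ndH.
have [i [j [ij Hij]]] : exists i j, i != j /\ H i j != 0.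
  case: (pickP (fun ij => (ij.1 != ij.2) && (H ij.1 ij.2 != 0))) =>
    [[i j] /andP[]|h].
    by exists i, j.
  case/is_diag_mxP: ndH => i j ij; apply/eqP.
  by have := h (i, j); rewrite /= ij /= => /negbFE.
pose s : 'S_(1 + n) := tperm 0 j.
pose K := row_perm s (col_perm s H).
have HK : sim H K.
  apply: (@sim_unit _ _ (perm_mx s)); first exact: unitmx_perm.
  by rewrite /K row_permE col_permE -!mulmxA -perm_mxM mulVg perm_mx1 mulmx1.
have k0 : s i != 0 by rewrite -(inj_eq (@perm_inj _ s)) tpermK tpermL.
case: (unliftP 0 (s i)) k0 => [k sik _|->]; last by rewrite eqxx.
exists (K 0 0), (ursubmx K), (dlsubmx K), (drsubmx K); split.
  apply: contraNneq Hij => /matrixP/(_ k 0)/eqP.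
  rewrite !mxE (_ : lshift n 0 = 0) ?tpermL; last exact: val_inj.
  congr (_ == 0); congr (H _ j).
  rewrite -[i](tpermK 0 j) sik; congr (s _).
  exact: val_inj.
have {1}-> : K 0 0 = ulsubmx K 0 0 by rewrite !mxE (_ : lshift n 0 = 0) //;
  apply: val_inj.
by rewrite -mx11_scalar submxK; apply: sim_trans GH HK.
Qed.

Lemma sim_block_ushear n m (A : 'M[F]_n) (B : 'M_(n, m)) (C : 'M_(m, n))
    (D : 'M_m) (Y : 'M_(n, m)) :
  sim (block_mx A B C D)
      (block_mx (A + Y *m C) (B + Y *m D - (A + Y *m C) *m Y) C (D - C *m Y)).
Proof.
exists (block_mx 1%:M Y 0 1%:M), (block_mx 1%:M (- Y) 0 1%:M).
rewrite !mulmx_block !(mul0mx, mulmx0, mul1mx, mulmx1, addr0, add0r).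
by rewrite addNr subrr -!scalar_mx_block addrCA subrr addr0 addrCA subrr addr0.
Qed.

Lemma sim_block_corner n m (A : 'M[F]_n) (B : 'M_(n, m))
    (C : 'M_(m, n)) (D D' : 'M_m) :
  sim D D' ->
  exists (B' : 'M_(n, m)) (C' : 'M_(m, n)), forall c,
    sim (block_mx A B C (c *: (C *m B) + D))
        (block_mx A B' C' (c *: (C' *m B') + D')).
Proof.
case=> P [Q [PQ QP PD]]; exists (B *m Q), (P *m C) => c.
exists (block_mx 1%:M 0 0 P), (block_mx 1%:M 0 0 Q).
rewrite !mulmx_block !(mul0mx, mulmx0, mul1mx, mulmx1, addr0, add0r).
rewrite PQ QP -!scalar_mx_block; split=> //.
rewrite -[B *m Q *m P]mulmxA QP mulmx1 mulmxDr mulmxDl PD.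
by rewrite -scalemxAl -scalemxAr -!mulmxA QP mulmx1.
Qed.

Lemma det_schur n (d : F) (r : 'rV[F]_n) (l : 'cV_n) (G : 'M_n) : d != 0 ->
  \det (block_mx d%:M r l (d^-1 *: (l *m r) + G)) = d * \det G.
Proof.
move=> d0.
have -> : block_mx d%:M r l (d^-1 *: (l *m r) + G)
    = block_mx 1%:M 0 (d^-1 *: l) 1%:M *m block_mx d%:M r 0 G.
  rewrite mulmx_block !(mul0mx, mulmx0, mul1mx, mulmx1, addr0, add0r).
  by rewrite -scalemxAl -scalemxAl mul_mx_scalar scalerA mulVf // scale1r.
by rewrite det_mulmx det_lblock det_ublock !det1 !mul1r det_scalar1.
Qed.

(** The pivot [d] can be prescribed, because conjugation by an upper shear
    adds s l to the corner, with l <> 0.  If the Schur complement happens to be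
    a scalar q, a second shear by t with t l = 0 and t <> 0 keeps the pivot and
    subtracts from the complement a nonzero multiple of the rank one matrix
    l t, which makes it nonscalar in size at least 2. *)
Lemma nonscalar_schur n (G : 'M[F]_(1 + n)) (d : F) :
  ~~ is_scalar_mx G -> G \in unitmx -> d != 0 ->
  exists (r : 'rV_n) (l : 'cV_n) (G' : 'M_n),
    (~~ is_scalar_mx G' || (n <= 1)%N) /\
    sim G (block_mx d%:M r l (d^-1 *: (l *m r) + G')).
Proof.
move=> nG uG d0.
have [a [r0 [l [G0 [l0 GG0]]]]] := nonscalar_sim_column nG.
have [k lk] : exists k, l k 0 != 0.
  by case/cV0Pn: l0 => k; exists k.
pose s : 'rV_n := ((d - a) / l k 0) *: delta_mx 0 k.
have sl : s *m l = (d - a)%:M.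
  rewrite /s -scalemxAl -rowE [row k l]mx11_scalar mxE.
  by rewrite scale_scalar_mx divfK.
have := sim_trans GG0 (sim_block_ushear a%:M r0 l G0 s).
have -> : a%:M + s *m l = d%:M by rewrite sl -raddfD /= addrCA subrr addr0.
move: (r0 + _ - _) (G0 - _) => r G1 GG1 {r0 G0 GG0 s sl}.
pose G2 := G1 - d^-1 *: (l *m r).
have eG1 : G1 = d^-1 *: (l *m r) + G2 by rewrite addrC subrK.
have [sG2|nG2] := boolP (is_scalar_mx G2); last first.
  by exists r, l, G2; rewrite nG2 -eG1.
have [n1|n1] := leqP n 1; first by exists r, l, G2; rewrite orbT -eG1.
have [q eG2] := is_scalar_mxP sG2.
have q0 : q != 0.
  move: uG; rewrite (sim_unitmx GG1) eG1 unitmxE det_schur // eG2 det_scalar.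
  rewrite unitfE mulf_eq0 negb_or => /andP[_]; rewrite expf_eq0 negb_and.
  by case/orP => //; rewrite lt0n negbK => /eqP n0; rewrite n0 in n1.
have [t tl t0] : exists2 t : 'rV_n, t *m l = 0 & t != 0.
  have : kermx l != 0.
    rewrite -mxrank_eq0 mxrank_ker -lt0n subn_gt0.
    exact: leq_ltn_trans (rank_leq_col l) n1.
  by case/rowV0Pn => t /sub_kermxP; exists t.
have := sim_trans GG1 (sim_block_ushear d%:M r l G1 t).
rewrite tl addr0 => GG2.
exists (r + t *m G1 - d%:M *m t), l, (q%:M - (q / d) *: (l *m t)); split.
  rewrite orbF; apply/negP => /is_scalar_mxP[p ep].
  have := congr1 (mulmx t) ep.
  rewrite mulmxBr -scalemxAr mulmxA tl mul0mx scaler0 subr0 !mul_mx_scalar.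
  move/eqP; rewrite -subr_eq0 -scalerBl scaler_eq0 (negPf t0) orbF subr_eq0.
  move/eqP=> qp; move: ep; rewrite -qp -[RHS]subr0 => /addrI/eqP.
  rewrite eqr_opp scaler_eq0 mulf_eq0 invr_eq0 (negPf q0) (negPf d0) /=.
  move/eqP => lt0; case/rV0Pn: t0 => m tm.
  have := congr1 (fun M : 'M_n => M k m) lt0.
  by rewrite !mxE big_ord1 => /eqP; rewrite mulf_eq0 (negPf lk) (negPf tm).
suff -> : d^-1 *: (l *m (r + t *m G1 - d%:M *m t))
    + (q%:M - (q / d) *: (l *m t)) = G1 - l *m t by [].
have tG1 : t *m G1 = q *: t.
  by rewrite eG1 mulmxDr -scalemxAr mulmxA tl mul0mx scaler0 add0r eG2
    mul_mx_scalar.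
rewrite tG1 mul_scalar_mx eG1 eG2 mulmxBr mulmxDr -!scalemxAr scalerBr scalerDr.
rewrite !scalerA mulVf // scale1r [q / d]mulrC -!addrA; congr (_ + _).
by rewrite addrC -!addrA addNr addr0 addrC.
Qed.

(** Only the first pivot differs between the recursion for determinant 1 and
    its use for determinant -1, so the step takes the result for the smaller
    size as a hypothesis. *)
Lemma nonscalar_factor_step n (G : 'M[F]_(1 + n)) (d : F) :
  (forall G' : 'M[F]_n, \det G' = 1 -> ~~ is_scalar_mx G' || (n <= 1)%N ->
     exists L R : 'M_n,
       [/\ unipotent_mx L, unipotent_mx R & sim G' (L *m R)]) ->
  ~~ is_scalar_mx G -> d != 0 -> \det G = d ->
  exists (r : 'rV_n) (l : 'cV_n) (L R : 'M_n),
    [/\ unipotent_mx L, unipotent_mx R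
      & sim G (block_mx d%:M r l (d^-1 *: (l *m r) + L *m R))].
Proof.
move=> IH nG d0 dG.
have uG : G \in unitmx by rewrite unitmxE dG unitfE.
have [r [l [G' [nG' GG']]]] := nonscalar_schur nG uG d0.
have dG' : \det G' = 1.
  by apply: (mulfI d0); rewrite mulr1 -(det_schur r l) // -(sim_det GG').
have [L [R [uL uR G'LR]]] := IH G' dG' nG'.
have [r' [l' h]] := sim_block_corner d%:M r l G'LR.
by exists r', l', L, R; split=> //; apply: sim_trans GG' (h _).
Qed.

(** In size 1 the determinant condition takes over: a scalar matrix of size 1
    and determinant 1 is the identity.  For larger sizes, G is similar to
    [[1, r], [l, l r + L R]] = [[1, 0], [l, L]] [[1, r], [0, R]]. *)
Lemma det1_prod_unipotent n (G : 'M[F]_n) : \det G = 1 ->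
  ~~ is_scalar_mx G || (n <= 1)%N ->
  exists L R : 'M_n, [/\ unipotent_mx L, unipotent_mx R & sim G (L *m R)].
Proof.
elim: n G => [|n IH] G dG nG.
  exists 1%:M, 1%:M; split; try exact: unipotent_1.
  by rewrite [G]flatmx0 [_ *m _]flatmx0; apply: sim_refl.
have [sG|{}nG] := boolP (is_scalar_mx G).
  move: nG; rewrite sG /= ltnS leqn0 => /eqP n0; subst n.
  exists 1%:M, 1%:M; split; try exact: unipotent_1.
  rewrite mulmx1 [G]mx11_scalar; move: dG; rewrite det_mx11 => ->.
  exact: sim_refl.
have [r [l [L [R [uL uR GLR]]]]] :=
  nonscalar_factor_step (n := n) IH nG (oner_neq0 F) dG.
exists (block_mx 1%:M 0 l L), (block_mx 1%:M r 0 R); split.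
- by apply: (@unipotent_lblock 1 n) => //; apply: unipotent_1.
- by apply: (@unipotent_ublock 1 n) => //; apply: unipotent_1.
have e : block_mx 1%:M 0 l L *m block_mx 1%:M r 0 R
    = block_mx 1%:M r l (l *m r + L *m R).
  by rewrite mulmx_block !(mul0mx, mulmx0, mul1mx, mulmx1, addr0, add0r).
by move: GLR; rewrite invr1 scale1r -e.
Qed.

(** The first pivot of - A is taken equal to d = det (- A), whose square is 1.
    With rho = diag (d, 1, ..., 1), the first row of rho B + 1 is
    (d + 1, 0, ..., 0), and (1 - d) (d + 1) = 0 gives the compatibility of rho
    with the correction. *)
Lemma stably_factorable_nonscalar n (A : 'M[F]_n) :
  A - 1%:M \in unitmx -> (\det A) ^+ 2 = 1 -> ~~ is_scalar_mx A ->
    stably_factorable A.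
Proof.
case: n A => [|n] A uA dA nA; first by rewrite [A]flatmx0 mx0_is_scalar in nA.
have nNA : ~~ is_scalar_mx (- A).
  apply: contra nA => /is_scalar_mxP[c e]; apply/is_scalar_mxP; exists (- c).
  by rewrite raddfN /= -e opprK.
set d := \det (- A).
have d2 : d * d = 1.
  rewrite -expr2 /d -scaleN1r detZ exprMn dA mulr1 -exprM mulnC exprM sqrrN.
  by rewrite !expr1n.
have d0 : d != 0.
  by apply/eqP => d0; move/eqP: d2; rewrite d0 mul0r eq_sym oner_eq0.
have dV : d^-1 = d by apply: (mulfI d0); rewrite d2 mulfV.
have [r [l [L [R [uL uR]]]]] :=
  nonscalar_factor_step (n := n) (@det1_prod_unipotent n) nNA d0 (erefl _).
rewrite dV; set A0 := block_mx _ _ _ _ => /sim_opp; rewrite opprK => AA0.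
apply: (sim_stably_factorable AA0).
apply: (@stably_factorable_of_factorization _ _ _ (block_mx 1%:M 0 l L)
  (block_mx 1%:M (d *: r) 0 R) (block_mx d%:M 0 0 1%:M)).
- by rewrite -(sim_unitmx (sim_sub1 AA0)).
- rewrite opprK !mulmx_block !(mul0mx, mulmx0, mul1mx, mulmx1, addr0, add0r).
  by rewrite mul_scalar_mx scalerA d2 scale1r -scalemxAr.
- rewrite mulmx_block !(mul0mx, mulmx0, mul1mx, addr0, add0r).
  by rewrite -scalar_mxM d2 -scalar_mx_block.
- rewrite mulmxA; congr (_ *m _).
  rewrite mulmx_block !(mul0mx, mulmx0, mul1mx, mulmx1, addr0, add0r).
  have -> : block_mx d%:M 0 l L + 1%:M = block_mx (d%:M + 1%:M) 0 l (L + 1%:M).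
    by rewrite scalar_mx_block add_block_mx !addr0.
  rewrite mulmx_block !(mul0mx, mulmx0, mul1mx, mulmx1, addr0, add0r).
  by rewrite mulmxDr mulmx1 -scalar_mxM d2 addrC.
apply: unipotent_prod_U2_U2; apply: unipotent_ublock.
  by apply: (@unipotent_ublock 1 n) => //; apply: unipotent_1.
by apply: (@unipotent_lblock 1 n) => //; apply: unipotent_1.
Qed.

End Nonscalar.

(** * Scalar matrices *)

Section Scalar.
Variable F : fieldType.

Lemma unitmx_comm_subX n (X Y : 'M[F]_n) k : GRing.comm X Y ->
  X ^+ k - Y ^+ k \in unitmx -> X - Y \in unitmx.
Proof.
by move=> cXY; rewrite (subrXX_comm k cXY) -mulmxE unitmx_mul => /andP[].
Qed.

Lemma unitmx_scalar n (a : F) : a != 0 -> (a%:M : 'M_n) \in unitmx.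
Proof. by move=> a0; rewrite unitmxE det_scalar unitfE expf_neq0. Qed.

Lemma scalar_mx_exp n (a : F) k : (a%:M : 'M_n) ^+ k = (a ^+ k)%:M.
Proof.
by elim: k => [|k IH]; rewrite ?expr0 // !exprS IH scalar_mxM.
Qed.

Lemma scalar_mx_comm n (X : 'M[F]_n) a : GRing.comm X a%:M.
Proof. exact: scalar_mxC. Qed.

(** The companion matrix of 'X^(m+1) - b, in a form suited to conjugation by
    diagonal matrices. *)
Definition weighted_cycle m (b : F) : 'M[F]_m.+1 :=
  \matrix_(i, j) ((if i == ord_max then b else 1) *+ (j == ordS i)).

Lemma delta_weighted_cycle m b (i : 'I_m.+1) :
  delta_mx (0 : 'I_1) i *m weighted_cycle m b
  = (if i == ord_max then b else 1) *: delta_mx 0 (ordS i).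
Proof.
rewrite -rowE; apply/rowP => j; rewrite !mxE eqxx /=.
by case: (j == _); rewrite ?mulr1 ?mulr0.
Qed.

Lemma weighted_cycle_exp m b : weighted_cycle m b ^+ m.+1 = b%:M.
Proof.
set P := weighted_cycle m b.
pose e k : 'rV[F]_m.+1 := delta_mx 0 (inord k).
have eS k : (k < m)%N -> e k *m P = e k.+1.
  move=> km; rewrite /e delta_weighted_cycle.
  have -> : ordS (inord k) = inord k.+1 :> 'I_m.+1.
    by apply: val_inj; rewrite /= !inordK ?modn_small ?ltnS // ltnW.
  by rewrite -val_eqE /= inordK ?ltnS ?ltn_eqF ?scale1r // ltnW.
have eP k : (k <= m)%N -> e k = e 0 *m P ^+ k.
  elim: k => [|k IH] km; first by rewrite expr0 mulmx1.
  by rewrite exprSr -mulmxE mulmxA -IH ?eS // ltnW.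
have e0 : e 0 *m P ^+ m.+1 = b *: e 0.
  rewrite exprSr -mulmxE mulmxA -eP // /e delta_weighted_cycle.
  have -> : inord m = ord_max :> 'I_m.+1 by apply: val_inj; rewrite /= inordK.
  have -> : ordS ord_max = inord 0 :> 'I_m.+1.
    by apply: val_inj; rewrite /= modnn inordK.
  by rewrite eqxx.
apply/row_matrixP => i; rewrite !rowE.
have <- : e i = delta_mx 0 i by rewrite /e inord_val.
have im : (i <= m)%N by rewrite -ltnS.
rewrite eP // -mulmxA mulmxE -exprD addnC exprD -mulmxE mulmxA e0.
by rewrite -scalemxAl mul_mx_scalar.
Qed.

(** The relation g P g^-1 = b P: conjugation by g multiplies the entry (i, j)
    of the shift by b^(j - i), which equals b also at the corner because
    b ^ (m + 1) = 1. *)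
Lemma diag_mx_conj_cycle m (b : F) : b ^+ m.+1 = 1 -> b != 0 ->
  let g := diag_mx (\row_(i < m.+1) b^-1 ^+ i) in
  b *: (weighted_cycle m b *m g) = g *m weighted_cycle m b.
Proof.
move=> bm b0 g.
have bmV : b^-1 ^+ m = b.
  have bm0 := expf_neq0 m b0.
  by rewrite exprVn; apply: (mulfI bm0); rewrite mulfV // -exprSr bm.
apply/matrixP => i j.
rewrite mul_mx_diag mul_diag_mx !mxE.
have [->|_] := eqVneq j (ordS i); last by rewrite mul0r !mulr0.
rewrite !mulr1n; have [->|im] := eqVneq i ord_max.
  by rewrite /= modnn expr0 mulr1 bmV.
have im' : (i < m)%N by rewrite ltn_neqAle -ltnS ltn_ord andbT.
by rewrite /= modn_small // mul1r mulr1 exprS mulrA mulfV // mul1r.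
Qed.

(** Take C = P with P ^ n = b, and B = b P^-1, which is conjugate to P^-1.  The
    matrices P - B and 1 + P are invertible because P ^ 2 - b and P + 1 divide
    P ^ (2 n) - b ^ n = b ^ 2 - 1 and P ^ n - (-1) ^ n = b - (-1) ^ n. *)
Lemma stably_factorable_scalar_root1 m (b : F) : b ^+ m.+1 = 1 -> b ^+ 2 != 1 ->
  stably_factorable ((- b)%:M : 'M_m.+1).
Proof.
move=> bm b2.
have b0 : b != 0 by apply/eqP => b0; move: bm; rewrite b0 expr0n => /eqP;
  rewrite eq_sym oner_eq0.
pose P := weighted_cycle m b.
have Pm : P ^+ m.+1 = b%:M := weighted_cycle_exp m b.
have uP : P \in unitmx.
  have : P *m P ^+ m \in unitmx by rewrite mulmxE -exprS Pm unitmx_scalar.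
  by rewrite unitmx_mul => /andP[].
have uP1 : 1%:M + P \in unitmx.
  have -> : 1%:M + P = P - (-1)%:M by rewrite raddfN opprK addrC.
  apply: (@unitmx_comm_subX _ _ _ m.+1).
    exact: scalar_mx_comm.
  rewrite Pm scalar_mx_exp -raddfB unitmx_scalar // subr_eq0.
  apply: contraNneq b2 => ->; by rewrite -exprM mulnC exprM sqrrN !expr1n.
have uP2 : P ^+ 2 - b%:M \in unitmx.
  apply: (@unitmx_comm_subX _ _ _ m.+1); first exact: scalar_mx_comm.
  rewrite -exprM mulnC exprM Pm !scalar_mx_exp bm -raddfB unitmx_scalar //.
  by rewrite subr_eq0.
pose B := b *: invmx P.
have PB : P *m B = b%:M by rewrite -scalemxAr mulmxV // scalemx1.
have BP : B *m P = b%:M by rewrite -scalemxAl mulVmx // scalemx1.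
apply: (@stably_factorable_of_factorization _ _ _ B P 1%:M).
- rewrite -raddfB unitmx_scalar // subr_eq0; apply: contraNneq b2 => b1.
  by rewrite -sqrrN b1 expr1n.
- by rewrite raddfN opprK mul1mx BP.
- by rewrite mulmx1.
- by rewrite mul1mx.
have uPB : P - B \in unitmx.
  move: uP2; rewrite expr2 -mulmxE -BP -mulmxBl unitmx_mul.
  by case/andP.
apply: (sim_prod_U2_U2 (sim_ublock _ uPB)); first by rewrite PB BP.
apply: sim_prod_U2_U2 (prod_U2_U2_inverse_pair uP uP1).
apply: sim_dsum; first exact: sim_refl.
pose g := diag_mx (\row_(i < m.+1) b^-1 ^+ i).
apply: (@sim_unit _ _ g).
  rewrite unitmxE det_diag unitfE; apply/prodf_neq0 => i _.
  by rewrite mxE expf_neq0 // invr_eq0.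
have e := diag_mx_conj_cycle bm b0; rewrite -/P -/g in e.
rewrite -[in RHS](mulmxK uP g) -e -scalemxAl -!scalemxAr !mulmxA.
by rewrite mulVmx // mul1mx.
Qed.

Lemma invmx_unique n (X Y : 'M[F]_n) : X *m Y = 1%:M -> invmx X = Y.
Proof.
by move=> XY; have [uX _] := mulmx1_unit XY; rewrite -[LHS]mulmx1 -XY mulKmx.
Qed.

Lemma sim_diag_perm n (f : 'I_n -> F) (s : 'S_n) :
  sim (diag_mx (\row_i f (s i))) (diag_mx (\row_i f i)).
Proof.
apply: sim_sym; apply: (@sim_unit _ _ (perm_mx s)); first exact: unitmx_perm.
apply/matrixP => i j; rewrite mul_mx_diag mul_diag_mx !mxE.
by case: eqP => [->|_]; rewrite ?mulr0 ?mul0r // mulr1 mul1r.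
Qed.

Lemma unitmx_diag n (f : 'I_n -> F) :
  (forall i, f i != 0) -> diag_mx (\row_i f i) \in unitmx.
Proof.
move=> f0; rewrite unitmxE det_diag unitfE; apply/prodf_neq0 => i _.
by rewrite mxE.
Qed.

Lemma diag_mxM n (f g : 'I_n -> F) :
  diag_mx (\row_i f i) *m diag_mx (\row_i g i) = diag_mx (\row_i (f i * g i)).
Proof. by rewrite mulmx_diag; congr diag_mx; apply/rowP => i; rewrite !mxE. Qed.

Lemma diag_mxD n (f g : 'I_n -> F) :
  diag_mx (\row_i f i) + diag_mx (\row_i g i) = diag_mx (\row_i (f i + g i)).
Proof. by rewrite -raddfD; congr diag_mx; apply/rowP => i; rewrite !mxE. Qed.

Lemma diag_mxN n (f : 'I_n -> F) :
  - diag_mx (\row_i f i) = diag_mx (\row_i - f i).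
Proof. by rewrite -raddfN; congr diag_mx; apply/rowP => i; rewrite !mxE. Qed.

Lemma diag_mx_const n (a : F) : (a%:M : 'M_n) = diag_mx (\row_i a).
Proof. by rewrite -diag_const_mx; congr diag_mx; apply/rowP => i; rewrite !mxE.
Qed.

(** Here the chain of eigenvalues has to end: C = diag (1, -b^-1, -b^-2, ...)
    and B = diag (-b, -b^2, ..., -b^n = 1).  The i-th entry of B is the inverse
    of the (i+1)-st entry of C, cyclically.  The products of corresponding
    entries are - b for the first and b for the others; rho = diag (-1, 1, ...)
    corrects this sign, and the first entry of C - 1 is zero, as the
    correction requires. *)
Lemma stably_factorable_scalar_rootN1 m (b : F) : b ^+ m.+1 = -1 ->
  -1 != 1 :> F ->
  b != -1 -> (forall i, (0 < i <= m)%N -> b ^+ i != 1) ->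
  stably_factorable ((- b)%:M : 'M_m.+1).
Proof.
move=> bm ch2 bN1 bi.
have b0 : b != 0.
  by apply/eqP => b0; move: bm; rewrite b0 exprS mul0r => e;
    case/eqP: (oner_neq0 F); rewrite -[1]opprK -e oppr0.
(* If b ^ e = 1 with e odd, then -1 = (-1) ^ e = (b ^ n) ^ e = 1. *)
have bodd k : b ^+ k.*2.+1 != 1.
  apply: contraNneq ch2 => e; have := congr1 (fun x => x ^+ m.+1) e.
  rewrite expr1n -exprM mulnC exprM bm -signr_odd /= odd_double /= expr1.
  by move=> ->.
pose c (i : 'I_m.+1) : F := if i == 0 then 1 else - b^-1 ^+ i.
pose d (i : 'I_m.+1) : F := - b ^+ i.+1.
pose rho (i : 'I_m.+1) : F := if i == 0 then -1 else 1.
have c0 i : c i != 0.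
  rewrite /c; case: (i == 0); first exact: oner_neq0.
  by rewrite oppr_eq0 expf_neq0 // invr_eq0.
have dc i : d i = (c (ordS i))^-1.
  have [->|im] := eqVneq i ord_max.
    have -> : ordS ord_max = 0 :> 'I_m.+1 by apply: val_inj; rewrite /= modnn.
    by rewrite /c eqxx /d bm opprK invr1.
  have im' : (i < m)%N by rewrite ltn_neqAle -ltnS ltn_ord andbT.
  rewrite /c /d -val_eqE /= modn_small //= exprVn invrN invrK //.
apply: (@stably_factorable_of_factorization _ _ _ (diag_mx (\row_i d i))
  (diag_mx (\row_i c i)) (diag_mx (\row_i rho i))).
- rewrite -raddfB unitmx_scalar // subr_eq0; apply: contraNneq bN1 => <-.
  by rewrite opprK.
- rewrite raddfN /= opprK !diag_mxM diag_mx_const; congr diag_mx;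
  apply/rowP => i.
  rewrite !mxE /rho /d /c; have [->|_] := eqVneq i 0;
    first by rewrite mulN1r opprK mulr1.
  by rewrite mul1r mulrNN exprVn exprS mulfK // expf_neq0.
- rewrite diag_mxM diag_mx_const; congr diag_mx; apply/rowP => i.
  by rewrite !mxE /rho; case: eqP; rewrite ?mulrNN mulr1.
- rewrite !diag_mx_const !diag_mxN !diag_mxM !diag_mxD !diag_mxM.
  congr diag_mx; apply/rowP => i; rewrite !mxE /rho /c.
  by case: eqP; rewrite ?mul1r // subrr !mulr0.
have uCD : diag_mx (\row_i c i) - diag_mx (\row_i d i) \in unitmx.
  rewrite diag_mxN diag_mxD; apply: unitmx_diag => i; rewrite /c /d opprK.
  have [->|_] := eqVneq i 0; first by rewrite expr1 addrC addr_eq0.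
  rewrite addrC subr_eq0; apply: contraNneq (bodd i) => e.
  by rewrite -addnn -addSn exprD e exprVn mulVf // expf_neq0.
apply: (sim_prod_U2_U2 (sim_ublock _ uCD)).
  by rewrite !diag_mxM; congr diag_mx; apply/rowP => i; rewrite !mxE mulrC.
have uC := unitmx_diag c0.
have uC1 : 1%:M + diag_mx (\row_i c i) \in unitmx.
  rewrite diag_mx_const diag_mxD; apply: unitmx_diag => i; rewrite /c.
  have [_|i0] := eqVneq i 0; first by rewrite addr_eq0 eq_sym.
  rewrite subr_eq0 eq_sym exprVn invr_eq1 bi // lt0n -ltnS ltn_ord andbT.
  exact: i0.
apply: sim_prod_U2_U2 (prod_U2_U2_inverse_pair uC uC1).
apply: sim_dsum; first exact: sim_refl.
have -> : invmx (diag_mx (\row_i c i)) = diag_mx (\row_i (c i)^-1).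
  apply: invmx_unique; rewrite diag_mxM diag_mx_const; congr diag_mx.
  by apply/rowP => i; rewrite !mxE mulfV.
have -> : diag_mx (\row_i d i) = diag_mx (\row_i (c (perm (@ordS_inj _) i))^-1).
  by congr diag_mx; apply/rowP => i; rewrite !mxE dc permE.
exact: (sim_diag_perm (fun i => (c i)^-1)).
Qed.

Lemma stably_factorable_0 (A : 'M[F]_0) : stably_factorable A.
Proof.
rewrite /stably_factorable;
  have -> : A = 1%:M by rewrite [LHS]flatmx0 [RHS]flatmx0.
by rewrite dsum1; apply/prod_inv_U2_U2_of_prod_U2_U2/prod_U2_U2_1.
Qed.

(** If b ^ n = -1 but b ^ i = 1 for some 0 < i < n, the scalar matrix splits
    into scalar blocks of sizes i and n - i with the same property, so that
    the chain construction is only needed for minimal n. *)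
Lemma stably_factorable_scalar n (a : F) :
  a != 1 -> (a ^+ n) ^+ 2 = 1 -> stably_factorable (a%:M : 'M_n).
Proof.
elim/ltn_ind: n => -[|m] IH a1 an; first exact: stably_factorable_0.
have [aN1|aN1] := eqVneq a (-1).
  apply: prod_inv_U2_U2_of_involution; apply: involution_dsum;
    last exact: involution_1.
  by rewrite /involution_mx -scalar_mxM aN1 mulrNN mulr1.
have [b eb] : exists b, a = - b by exists (- a); rewrite opprK.
have sq k : (a ^+ k) ^+ 2 = (b ^+ k) ^+ 2.
  by rewrite -!exprM mulnC !exprM eb sqrrN.
have b1 : b != 1 by apply: contraNneq aN1 => b1; rewrite eb b1.
have bN1 : b != -1 by apply: contraNneq a1 => b1'; rewrite eb b1' opprK.
have := an; rewrite sq => /eqP; rewrite sqrf_eq1 => /orP[/eqP bm|/eqP bm].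
  by rewrite eb; apply: stably_factorable_scalar_root1;
    rewrite // sqrf_eq1 negb_or b1.
have [ch2|ch2] := eqVneq (-1 : F) 1.
  rewrite eb; apply: stably_factorable_scalar_root1; first by rewrite bm.
  by rewrite sqrf_eq1 negb_or b1.
case: (pickP (fun i : 'I_m.+1 => (0 < i)%N && (b ^+ i == 1))) =>
  [i /andP[i0 /eqP bi]|nb].
  have [k ek] : exists k, m.+1 = (i + k)%N by exists (m.+1 - i)%N;
    rewrite subnKC // ltnW.
  have bk : b ^+ k = -1 by rewrite -bm ek exprD bi mul1r.
  have im := ltn_ord i.
  have km : (k < m.+1)%N by rewrite [X in (_ < X)%N]ek -[X in (X < _)%N]add0n
    ltn_add2r.
  have gi : stably_factorable (a%:M : 'M_i) by apply: IH;
    rewrite // sq bi expr1n.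
  have gk : stably_factorable (a%:M : 'M_k) by apply: IH;
    rewrite // sq bk sqrrN expr1n.
  rewrite ek [a%:M]scalar_mx_block; exact: stably_factorable_dsum.
rewrite eb; apply: stably_factorable_scalar_rootN1 => // i /andP[i0 im].
have := nb (Ordinal (im : (i < m.+1)%N)).
by rewrite /= i0 /= => ->.
Qed.

End Scalar.

(** * The factorization theorem *)

Lemma stably_factorable_det_sqr1 (F : fieldType) (n : nat) (A : 'M[F]_n) :
  (\det A) ^+ 2 = 1 -> stably_factorable A.
Proof.
move=> dA; have [p [q [A1 [A2 [AA uA1 uA2]]]]] := fitting_at_1 A.
apply: (sim_stably_factorable AA); apply: stably_factorable_dsum; last first.
  apply: prod_inv_U2_U2_of_prod_U2_U2;
    apply: prod_U2_U2_dsum (prod_U2_U2_1 _ _).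
  exact: unipotent_prod_U2_U2.
have dA1 : (\det A1) ^+ 2 = 1.
  by rewrite -dA (sim_det AA) det_ublock (det_unipotent uA2) mulr1.
have [/is_scalar_mxP[a eA]|nA] := boolP (is_scalar_mx A1); last first.
  exact: stably_factorable_nonscalar.
case: p A1 AA uA1 dA1 eA => [|p] A1 _ uA1 dA1 eA;
  first exact: stably_factorable_0.
rewrite eA in uA1 dA1 *; apply: stably_factorable_scalar;
  last by rewrite det_scalar in dA1.
apply: contraTneq uA1 => a1.
by rewrite a1 subrr unitmxE det0 unitr0.
Qed.

Theorem theorem1p10 (F : fieldType) (n : nat) (hn : (1 <= n)%N)
    (A : 'M[F]_n) (hA : \det A = 1 \/ \det A = -1) :
  prod_involution_U2_U2 (block_mx A 0 0 (1%:M : 'M[F]_n)).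
Proof.
have dA : (\det A) ^+ 2 = 1 by case: hA => ->; rewrite ?sqrrN expr1n.
have [S [N [hS [U [V [hU hV ->]]] e]]] := stably_factorable_det_sqr1 dA.
by exists S, U, V; split=> //; apply: Or31; rewrite -mulmxA.
Qed.
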